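(* Let $(X,d)$ be a geodesic space with convex metric, $C \subseteq X$ nonempty, $\lambda\in(0,1)$ and $T : C \to C$ a $\lambda$-firmly nonexpansive mapping. Let $x,y \in C$ and let $b \ge \max\{d(x,y), d(x,Tx)\}$. Then for all $\varepsilon > 0$ and all $n \ge \Phi(\varepsilon, b, \lambda)$, $$d(T^n x, T^{n+1} x) \le d(y,Ty) + \varepsilon,$$ where $$\Phi(\varepsilon, b, \lambda) := M\left\lceil \frac{2 b (1 + e^{KM})}{\varepsilon}\right\rceil, \qquad K = \left\lceil \frac{1}{\lambda}\right\rceil, \qquad M = \left\lceil\frac{4b}{\varepsilon}\right\rceil.$$
   Context: A geodesic path from $x$ to $y$ in a metric space $(X,d)$ is a map $c:[0,l]\to X$ with $c(0)=x$, $c(l)=y$ and $d(c(t),c(t'))=|t-t'|$ for all $t,t'\in[0,l]$; its image is a geodesic segment joining $x$ and $y$. $X$ is a geodesic space if any two points are joined by a geodesic path (not necessarily unique). A point $z$ lies on a geodesic segment $[x,y]$ iff for some $t\in[0,1]$ one has $d(z,x)=t\,d(x,y)$ and $d(z,y)=(1-t)d(x,y)$, and one writes $z=(1-t)x+ty$ (such a point need not be unique when several segments join $x$ and $y$). The metric is convex if for all $x,y,z\in X$ and $t\in[0,1]$, $d(x,(1-t)y+tz)\le(1-t)d(x,y)+t\,d(x,z)$. For $C\subseteq X$ and $\lambda\in(0,1)$, a map $T:C\to X$ is $\lambda$-firmly nonexpansive if $T$ is nonexpansive ($d(Tx,Ty)\le d(x,y)$ for all $x,y\in C$) and for all $x,y\in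 C$, $$d(Tx,Ty)\le d((1-\lambda)x+\lambda Tx,(1-\lambda)y+\lambda Ty),$$ where, if $X$ is not uniquely geodesic, a geodesic segment joining $z$ and $Tz$ is fixed beforehand for each $z\in C$, and $(1-\lambda)z+\lambda Tz$ denotes the point of that segment at distance $\lambda d(z,Tz)$ from $z$. $C$ is not assumed convex. *)

(* Defs.v *)
From HB Require Import structures.
From mathcomp Require Import all_boot all_order all_algebra.
From mathcomp Require Import all_classical all_reals all_analysis.

Set Implicit Arguments.
Unset Strict Implicit.
Unset Printing Implicit Defensive.

Import Order.TTheory GRing.Theory Num.Theory.

Local Open Scope classical_set_scope.
Local Open Scope ring_scope.

(* Only the values of [c] on [0, l] matter: paths and maps defined on a subset
   are represented by total functions that are constrained on that subset. *)
Definition geodesic_path (R : realType) (X : metricType R) (x y : X) (l : R)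
    (c : R -> X) : Prop :=
  [/\ 0 <= l, c 0 = x, c l = y &
      forall t t' : R, 0 <= t <= l -> 0 <= t' <= l ->
        mdist (c t) (c t') = `|t - t'|].

Definition geodesic_space (R : realType) (X : metricType R) : Prop :=
  forall x y : X, exists l : R, exists c : R -> X, geodesic_path x y l c.

(* [z = (1 - t) x + t y], as a relation since [z] need not be unique. *)
Definition convex_comb (R : realType) (X : metricType R) (t : R) (x y z : X)
    : Prop :=
  mdist z x = t * mdist x y /\ mdist z y = (1 - t) * mdist x y.

Definition convex_metric (R : realType) (X : metricType R) : Prop :=
  forall (x y z w : X) (t : R), 0 <= t <= 1 -> convex_comb t y z w ->
    mdist x w <= (1 - t) * mdist x y + t * mdist x z.

(* [seg z] is the geodesic from [z] to [T z] fixed beforehand. *)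
Definition segment_choice (R : realType) (X : metricType R) (C : set X)
    (T : X -> X) (seg : X -> R -> X) : Prop :=
  forall z : X, C z -> geodesic_path z (T z) (mdist z (T z)) (seg z).

(* [(1 - lambda) z + lambda T z], taken on the fixed segment. *)
Definition averaged (R : realType) (X : metricType R) (T : X -> X)
    (seg : X -> R -> X) (lambda : R) (z : X) : X :=
  seg z (lambda * mdist z (T z)).

Definition nonexpansive (R : realType) (X : metricType R) (C : set X)
    (T : X -> X) : Prop :=
  forall x y : X, C x -> C y -> mdist (T x) (T y) <= mdist x y.

Definition firmly_nonexpansive (R : realType) (X : metricType R) (C : set X)
    (seg : X -> R -> X) (lambda : R) (T : X -> X) : Prop :=
  nonexpansive C T /\
  forall x y : X, C x -> C y ->
    mdist (T x) (T y) <=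
    mdist (averaged T seg lambda x) (averaged T seg lambda y).

Definition rateK (R : realType) (lambda : R) : int := Num.ceil (1 / lambda).

Definition rateM (R : realType) (eps b : R) : int := Num.ceil (4 * b / eps).

Definition Phi (R : realType) (eps b lambda : R) : int :=
  let K := rateK lambda in
  let M := rateM eps b in
  M * Num.ceil (2 * b * (1 + expR (K * M)%:~R) / eps).

(* Main.v *)
Require Import Defs.
From HB Require Import structures.
From mathcomp Require Import all_boot all_order all_algebra.
From mathcomp Require Import all_classical all_reals all_analysis.
From mathcomp Require Import ring lra.

(** Let [T] be lambda-firmly nonexpansive and write [D k j] for the distance from
    [T^j x] to [T^(j + k) x].  Applying convexity of the metric once in each
    variable to the points [(1 - lambda) x + lambda T x] and
    [(1 - lambda) y + lambda T y] turns firm nonexpansiveness into the four-point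
    inequality
      [(1 + lambda) d(Tx, Ty)
         <= (1 - lambda) d(x, y) + lambda (d(Tx, y) + d(x, Ty))]
    ([firm_four_points]).  Along the orbit of [x] this bounds [D (k + 2) j] from
    below by a combination of [D (k + 1) (j + 1)], [D (k + 1) j] and
    [D k (j + 1)].

    If the step lengths [D 1 j] lie in [[A - delta, A]] for [M] consecutive
    indices starting at [i], this recursion forces the orbit to be almost
    straight: [D M i >= M A - (1 + 1 / lambda)^(M - 1) delta]
    ([almost_straight]).  On the other hand [D M i <= 2 d(x, y) + M d(y, Ty)],
    because the orbits of [x] and [y] stay within [d(x, y)] of each other and
    that of [y] makes steps of length at most [d(y, Ty)].  Comparing the two
    bounds and dividing by [M] bounds [A], hence every later step length.

    The step lengths never increase and the first is at most [b], so among [N] consecutive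
    blocks of [M] indices some block has a drop of at most [delta = b / N]
    ([small_drop]).  This yields [orbit_step_le].  The stated rate results from
    [1 + 1 / lambda <= exp K] and from choosing [M] and [N] so that [2 b / M] and
    [exp (K M) b / N] are both at most [eps / 2]. *)

Set Implicit Arguments.
Unset Strict Implicit.
Unset Printing Implicit Defensive.

Import Order.TTheory GRing.Theory Num.Theory.

Local Open Scope classical_set_scope.
Local Open Scope ring_scope.

(** * Two estimates on real sequences *)

(** Pigeonhole: if [u N] is nonnegative, then [u] cannot drop by more than
    [u 0 / N] at each of its first [N] steps. *)
Lemma small_drop (R : realFieldType) (u : nat -> R) (N : nat) :
  (0 < N)%N -> 0 <= u N ->
  exists2 i : nat, (i < N)%N & u i - u i.+1 <= u 0 / N%:R.
Proof.
case: N => // N _ uN0; apply: contrapT => no_small.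
pose c := u 0 / N.+1%:R.
have large k : (k <= N)%N -> c < u k - u k.+1.
  by move=> kN; rewrite ltNge; apply/negP => le_k; apply: no_small; exists k.
have total k : (k <= N)%N -> u k.+1 < u 0 - k.+1%:R * c.
  elim: k => [|k IH] kN; have := large _ kN; first by rewrite mul1r; lra.
  by have := IH (ltnW kN); rewrite -[k.+2%:R]natr1 mulrDl mul1r; lra.
have := total N (leqnn N).
by rewrite mulrC divfK ?pnatr_eq0// subrr ltNge uN0.
Qed.

(** [D k j] stands for the distance between the points of index [j] and [j + k]
    of an orbit.  If its steps are nearly constant from [i] to [i + m], the
    recursion makes [D] nearly additive there: the defect is multiplied by at
    most [1 + 1 / lambda] each time [k] grows by one. *)
Lemma almost_straight (R : realFieldType) (lambda A delta : R)
    (D : nat -> nat -> R) (i m : nat) :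
  0 < lambda -> lambda <= 1 ->
  (forall k j, (1 + lambda) * D k.+1 j.+1 <=
               (1 - lambda) * D k.+1 j + lambda * (D k j.+1 + D k.+2 j)) ->
  (forall k j, (i <= j)%N -> D k j <= k%:R * A) ->
  (forall j, (i <= j <= i + m)%N -> A - delta <= D 1%N j) ->
  forall k j, (i <= j)%N -> (j + k <= i + m)%N ->
    k.+1%:R * A - (1 + lambda^-1) ^+ k * delta <= D k.+1 j.
Proof.
move=> l0 l1 rec up low; elim=> [|k IH] j ij jk.
  by rewrite expr0 !mul1r; apply: low; rewrite ij -(addn0 j).
have IHj : k.+1%:R * A - (1 + lambda^-1) ^+ k * delta <= D k.+1 j.+1.
  by apply: IH; [exact: leqW | rewrite addSnnS].
have up1 := up k.+1 j ij; have up0 := up k j.+1 (leqW ij).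
have := rec k j.
rewrite exprS; move: IHj up1 up0; rewrite -!natr1.
set e := (1 + lambda^-1) ^+ k * delta; rewrite -mulrA -/e => IHj up1 up0 recj.
have lI : lambda * lambda^-1 = 1 by rewrite divff// gt_eqF.
have h1 := ler_wpM2l (ltW (ltr_wpDl ler01 l0) : 0 <= 1 + lambda) IHj.
have h2 : (1 - lambda) * D k.+1 j <= (1 - lambda) * ((k%:R + 1) * A).
  by apply: ler_wpM2l up1; rewrite subr_ge0.
have h3 := ler_wpM2l (ltW l0) up0.
rewrite -(ler_pM2l l0).
have -> : lambda * ((k%:R + 1 + 1) * A - (1 + lambda^-1) * e) =
  lambda * ((k%:R + 1 + 1) * A) - lambda * e - (lambda * lambda^-1) * e by ring.
rewrite lI; lra.
Qed.

(** * The four-point inequality *)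

Lemma averaged_convex_comb (R : realType) (X : metricType R) (C : set X)
    (T : X -> X) (seg : X -> R -> X) (lambda : R) (z : X) :
  0 <= lambda <= 1 -> segment_choice C T seg -> C z ->
  convex_comb lambda z (T z) (averaged T seg lambda z).
Proof.
move=> /andP[l0 l1] segP Cz; have [d0 s0 s1 sd] := segP z Cz.
set d := mdist z (T z) in d0 s0 s1 sd *.
have ld : 0 <= lambda * d <= d by rewrite mulr_ge0//= ler_piMl.
rewrite /convex_comb /averaged -/d; split.
- by rewrite -[X in mdist _ X]s0 sd ?lexx ?d0// subr0 ger0_norm// mulr_ge0.
- rewrite -[X in mdist _ X]s1 sd ?lexx ?d0// ler0_norm ?subr_le0 ?(andP ld).2//.
  by rewrite opprB mulrBl mul1r.
Qed.

(** The only consequence of firm nonexpansiveness that is used beyond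
    nonexpansiveness: it no longer mentions the averaged points. *)
Lemma firm_four_points (R : realType) (X : metricType R) (C : set X)
    (lambda : R) (T : X -> X) (seg : X -> R -> X) (x y : X) :
  convex_metric X -> 0 <= lambda -> lambda < 1 ->
  segment_choice C T seg -> firmly_nonexpansive C seg lambda T ->
  C x -> C y ->
  (1 + lambda) * mdist (T x) (T y) <=
  (1 - lambda) * mdist x y + lambda * (mdist (T x) y + mdist x (T y)).
Proof.
move=> cX l0 l1 segP [_ firm] Cx Cy.
have l01 : 0 <= lambda <= 1 by rewrite l0 ltW.
have avx := averaged_convex_comb l01 segP Cx.
have avy := averaged_convex_comb l01 segP Cy.
set u := averaged T seg lambda x in avx *.
set v := averaged T seg lambda y in avy *.
have h := firm x y Cx Cy; rewrite -/u -/v in h.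
(* Convexity is used once along the segment of [y] and twice along that of
   [x]. *)
have huv := cX u y (T y) v lambda l01 avy.
have hy := cX y x (T x) u lambda l01 avx.
have hTy := cX (T y) x (T x) u lambda l01 avx.
rewrite ![mdist y _]metric_sym ![mdist (T y) _]metric_sym in hy hTy.
(* The term in [mdist (T x) (T y)] on the right is absorbed on the left, leaving
   the coefficient 1 - lambda ^ 2, which is divided by 1 - lambda. *)
have l1' : 0 < 1 - lambda by rewrite subr_gt0.
have wy := ler_wpM2l (ltW l1') hy; have wTy := ler_wpM2l l0 hTy.
rewrite -(ler_pM2l l1'); lra.
Qed.

(** * Orbits of nonexpansive maps *)

Section Orbit.
Context (R : realType) (X : metricType R) (C : set X) (T : X -> X).
Hypothesis T_stable : forall z : X, C z -> C (T z).
Hypothesis T_nonexp : nonexpansive C T.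
Implicit Types (x y : X) (i j k n : nat).

Lemma iter_stable x n : C x -> C (iter n T x).
Proof. by move=> Cx; elim: n => //= n; exact: T_stable. Qed.

Lemma mdist_iter_le x y n : C x -> C y ->
  mdist (iter n T x) (iter n T y) <= mdist x y.
Proof.
move=> Cx Cy; elim: n => //= n; apply: le_trans.
by apply: T_nonexp; exact: iter_stable.
Qed.

Lemma orbit_step_nincr x i j : C x -> (i <= j)%N ->
  mdist (iter j T x) (iter j.+1 T x) <= mdist (iter i T x) (iter i.+1 T x).
Proof.
move=> Cx ij; rewrite -(subnK ij) -addnS !iterD.
by apply: mdist_iter_le; exact: iter_stable.
Qed.

Lemma orbit_mdist_le x j k : C x ->
  mdist (iter j T x) (iter (j + k) T x) <=
  k%:R * mdist (iter j T x) (iter j.+1 T x).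
Proof.
move=> Cx; elim: k => [|k IH]; first by rewrite addn0 mdistxx mul0r.
apply: le_trans (metric_triangle _ (iter (j + k) T x) _) _.
rewrite -natr1 mulrDl mul1r addnS; apply: lerD IH _.
by apply: orbit_step_nincr => //; exact: leq_addr.
Qed.

(** The detour through the orbit of [y] costs at most [mdist x y] at either end. *)
Lemma orbit_mdist_le_step x y j k : C x -> C y ->
  mdist (iter j T x) (iter (j + k) T x) <=
  2 * mdist x y + k%:R * mdist y (T y).
Proof.
move=> Cx Cy.
have t1 := metric_triangle (iter j T x) (iter j T y) (iter (j + k) T x).
have t2 := metric_triangle (iter j T y) (iter (j + k) T y) (iter (j + k) T x).
have hj := mdist_iter_le j Cx Cy.
have hjk := mdist_iter_le (j + k) Cy Cx; rewrite (metric_sym y x) in hjk.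
have hy := orbit_mdist_le j k Cy.
have hs := ler_wpM2l (ler0n R k) (orbit_step_nincr Cy (leq0n j)).
rewrite /= in hs; lra.
Qed.

End Orbit.

(** * The rate *)

(** The estimate behind the rate, with the block length [m + 1] and the number
    [N] of blocks left free. *)
Lemma orbit_step_le (R : realType) (X : metricType R) (C : set X)
    (lambda : R) (T : X -> X) (seg : X -> R -> X) (x y : X) (m N n : nat) :
  convex_metric X -> 0 < lambda -> lambda < 1 ->
  (forall z : X, C z -> C (T z)) ->
  segment_choice C T seg -> firmly_nonexpansive C seg lambda T ->
  C x -> C y -> (0 < N)%N -> (m.+1 * N <= n)%N ->
  m.+1%:R * mdist (iter n T x) (iter n.+1 T x) <=
  m.+1%:R * mdist y (T y) + 2 * mdist x y +
  (1 + lambda^-1) ^+ m * (mdist x (T x) / N%:R).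
Proof.
move=> cX l0 l1 Tst segP firm Cx Cy N0 mNn.
have nonexp := firm.1.
pose D k j := mdist (iter j T x) (iter (j + k) T x).
have D1 j : D 1%N j = mdist (iter j T x) (iter j.+1 T x) by rewrite /D addn1.
have nincr i j : (i <= j)%N -> D 1%N j <= D 1%N i.
  by move=> ij; rewrite !D1; exact: (orbit_step_nincr Tst nonexp).
have [p pN drop] := small_drop (u := fun p => D 1%N (m.+1 * p)%N) N0
  (mdist_ge0 _ _).
rewrite muln0 (D1 0%N) /= in drop.
set i := (m.+1 * p)%N in drop; set delta := mdist x (T x) / N%:R in drop *.
rewrite mulnS addnC -/i in drop.
have lower : m.+1%:R * D 1%N i - (1 + lambda^-1) ^+ m * delta <= D m.+1 i.
  apply: (@almost_straight _ _ _ _ D i m) => //; first exact: ltW.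
  - move=> k j.
    have := firm_four_points cX (ltW l0) l1 segP firm
      (iter_stable Tst j Cx) (iter_stable Tst (j + k.+1) Cx).
    by rewrite /D -!iterS !addnS !addSn.
  - move=> k j ij; apply: le_trans (orbit_mdist_le Tst nonexp j k Cx) _.
    by rewrite -D1 ler_wpM2l// nincr.
  - move=> j /andP[ij jim]; have : D 1%N (i + m.+1)%N <= D 1%N j.
      by apply: nincr; rewrite addnS leqW.
    lra.
have upper : D m.+1 i <= 2 * mdist x y + m.+1%:R * mdist y (T y).
  exact: (orbit_mdist_le_step Tst nonexp).
have last_step : m.+1%:R * D 1%N n <= m.+1%:R * D 1%N i.
  rewrite ler_wpM2l// nincr// (leq_trans _ mNn)// leq_mul2l.
  by rewrite (ltnW pN) orbT.
rewrite -D1; lra.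
Qed.

Theorem theorem4p4 (R : realType) (X : metricType R)
    (geodX : geodesic_space X) (convX : convex_metric X)
    (C : set X) (C_neq0 : C !=set0)
    (lambda : R) (lambda_gt0 : 0 < lambda) (lambda_lt1 : lambda < 1)
    (T : X -> X) (T_stable : forall z : X, C z -> C (T z))
    (seg : X -> R -> X) (segP : segment_choice C T seg)
    (T_firm : firmly_nonexpansive C seg lambda T)
    (x y : X) (Cx : C x) (Cy : C y)
    (b : R) (b_ge : Num.max (mdist x y) (mdist x (T x)) <= b) :
  forall eps : R, 0 < eps ->
  forall n : nat, Phi eps b lambda <= n%:Z ->
    mdist (iter n T x) (iter n.+1 T x) <= mdist y (T y) + eps.
Proof.
move=> eps eps0 n Phin.
move: b_ge; rewrite ge_max => /andP[xyb xTb].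
have [b0|b_neq0] := eqVneq b 0.
  (* Here [x] is a fixed point; there are no blocks to speak of, as [M = 0]. *)
  have := orbit_step_nincr T_stable T_firm.1 Cx (leq0n n).
  rewrite b0 in xTb; have := mdist_ge0 y (T y); rewrite /=; lra.
have b_gt0 : 0 < b.
  by rewrite lt_def b_neq0 (le_trans (mdist_ge0 _ _) xTb).
move: Phin; rewrite /Phi; set K := rateK lambda; set M := rateM eps b.
set E := expR _; set N := Num.ceil _ => MNn.
have E0 : 0 < E by exact: expR_gt0.
have M_ge : 4 * b / eps <= M%:~R by exact: ceil_ge.
have N_ge : 2 * b * (1 + E) / eps <= N%:~R by exact: ceil_ge.
have K_ge : 1 / lambda <= K%:~R by exact: ceil_ge.
have M0 : 0 < M.
  by rewrite -(ltr0z R); apply: lt_le_trans M_ge; rewrite divr_gt0// mulr_gt0.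
have N0 : 0 < N.
  by rewrite -(ltr0z R); apply: lt_le_trans N_ge; rewrite !(divr_gt0, mulr_gt0)//;
    lra.
case: M @E N M0 N0 MNn M_ge N_ge E0 => // -[//|m] E [] // N M0 N0 MNn M_ge N_ge E0.
have step := orbit_step_le (m := m) (N := N) (n := n) convX lambda_gt0 lambda_lt1
  T_stable segP T_firm Cx Cy N0 MNn.
have growth : (1 + lambda^-1) ^+ m <= E.
  have l'0 : 0 < lambda^-1 by rewrite invr_gt0.
  have le_e : 1 + lambda^-1 <= expR K%:~R.
    apply: le_trans (expR_ge1Dx _) _; rewrite ler_expR.
    by rewrite div1r in K_ge.
  have -> : E = expR K%:~R ^+ m.+1.
    by rewrite -expRM_natl /E intrM mulrC.
  apply: le_trans (lerXn2r m _ _ le_e) _.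
  - by rewrite nnegrE; lra.
  - by rewrite nnegrE expR_ge0.
  - by apply: ler_weXn2l => //; lra.
have N0R : 0 < N%:R :> R by rewrite ltr0n.
have drop : (1 + lambda^-1) ^+ m * (mdist x (T x) / N%:R) <= eps / 2.
  apply: le_trans (ler_wpM2r _ growth) _; first by rewrite divr_ge0// mdist_ge0.
  rewrite mulrA ler_pdivrMr//; move: N_ge; rewrite ler_pdivrMr// => N_ge.
  have := ler_wpM2l (ltW E0) xTb; rewrite (_ : N%:~R = N%:R)// in N_ge; lra.
have M1 : 1 <= m.+1%:R :> R by rewrite ler1n.
have M_eps : 4 * b <= m.+1%:R * eps by rewrite -ler_pdivrMr.
have eps_M : eps <= m.+1%:R * eps by rewrite ler_peMl// ltW.
rewrite -(@ler_pM2l _ m.+1%:R) ?ltr0n//; lra.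
Qed.
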